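(* Assume that $X\in 2^\omega$ is $\Delta^0_2$ and has DNC degree relative to $A\in 2^\omega$. Then $A$ is $GL_1$, i.e., $A'\leq_T A\oplus\emptyset'$.
   Context: $X$ has DNC degree relative to $A$ if $X$ computes a function $g\colon\omega\to\omega$ with $g(e)\neq\varphi^A_e(e)$ whenever $\varphi^A_e(e)$ is defined. *)

(* Defs.v *)
From Stdlib Require Import Arith Bool Lia Cantor ClassicalEpsilon.

Definition cantor_space := nat -> bool.

Definition empty_set : cantor_space := fun _ => false.

Notation "⟨ x , y ⟩" := (Cantor.to_nat (x, y)) (at level 0, x at level 99, y at level 99).

(* Kleene's schemes for the functions partial recursive in an oracle.  All
   programs are unary: several arguments are passed through Cantor's pairing. *)
Inductive code : Type :=
  | Zero | Succ | Fst | Snd | Oracle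
  | Pair (c d : code)
  | Comp (c d : code)
  | Prec (c d : code)
  | Mu (c : code).

Fixpoint prec_graph (F G : nat -> nat -> Prop) (x n y : nat) : Prop :=
  match n with
  | 0 => F x y
  | S m => exists v, prec_graph F G x m v /\ G ⟨x, ⟨m, v⟩⟩ y
  end.

(* [eval A c x y]: the program [c] with oracle [A] halts on [x] with value [y].
   [Prec c d] sends (x, 0) to c(x) and (x, m+1) to d(x, (m, Prec c d (x, m)));
   [Mu c] sends x to the least n with c(x, n) = 0, and is undefined if there
   is none or if c(x, m) diverges for some m before the first zero. *)
Fixpoint eval (A : cantor_space) (c : code) : nat -> nat -> Prop :=
  match c with
  | Zero => fun _ y => y = 0
  | Succ => fun x y => y = S x
  | Fst => fun x y => y = fst (Cantor.of_nat x)
  | Snd => fun x y => y = snd (Cantor.of_nat x)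
  | Oracle => fun x y => y = Nat.b2n (A x)
  | Pair c d => fun x y =>
      exists u v, eval A c x u /\ eval A d x v /\ y = ⟨u, v⟩
  | Comp c d => fun x y => exists u, eval A d x u /\ eval A c u y
  | Prec c d => fun x y =>
      prec_graph (eval A c) (eval A d)
        (fst (Cantor.of_nat x)) (snd (Cantor.of_nat x)) y
  | Mu c => fun x n =>
      eval A c ⟨x, n⟩ 0 /\
      forall m, m < n -> exists k, eval A c ⟨x, m⟩ (S k)
  end.

Fixpoint encode (c : code) : nat :=
  match c with
  | Zero => ⟨0, 0⟩
  | Succ => ⟨1, 0⟩
  | Fst => ⟨2, 0⟩
  | Snd => ⟨3, 0⟩
  | Oracle => ⟨4, 0⟩
  | Pair c d => ⟨5, ⟨encode c, encode d⟩⟩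
  | Comp c d => ⟨6, ⟨encode c, encode d⟩⟩
  | Prec c d => ⟨7, ⟨encode c, encode d⟩⟩
  | Mu c => ⟨8, encode c⟩
  end.

(* The graph of φ_e^A; an [e] that encodes no program indexes the nowhere
   defined function. *)
Definition phi (A : cantor_space) (e x y : nat) : Prop :=
  exists c, encode c = e /\ eval A c x y.

Lemma encode_inj (c d : code) : encode c = encode d -> c = d.
Proof.
revert d; induction c as [| | | | |c IHc c' IHc'|c IHc c' IHc'|c IHc c' IHc'|c IHc];
  intros []; cbn [encode]; intros H; apply Cantor.to_nat_inj in H;
  try discriminate H; try reflexivity;
  apply (f_equal snd) in H; cbn [snd] in H.
1-3: apply Cantor.to_nat_inj in H; injection H as H H'; f_equal; auto.
f_equal; auto.
Qed.

Lemma eval_fun (A : cantor_space) (c : code) (x y z : nat) :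
  eval A c x y -> eval A c x z -> y = z.
Proof.
revert x y z; induction c as [| | | | |c IHc d IHd|c IHc d IHd|c IHc d IHd|c IHc];
  cbn [eval]; intros x y z; try congruence.
- intros (u & v & Hu & Hv & ->) (u' & v' & Hu' & Hv' & ->).
  now rewrite (IHc _ _ _ Hu Hu'), (IHd _ _ _ Hv Hv').
- intros (u & Hu & Hy) (u' & Hu' & Hz).
  rewrite <- (IHd _ _ _ Hu Hu') in Hz; eauto.
- destruct (Cantor.of_nat x) as [a n]; cbn [fst snd].
  revert y z; induction n as [|n IHn]; cbn [prec_graph]; intros y z.
  + apply IHc.
  + intros (v & Hv & Hy) (v' & Hv' & Hz).
    rewrite <- (IHn _ _ Hv Hv') in Hz; eauto.
- intros [Hy Ly] [Hz Lz].
  destruct (Nat.lt_trichotomy y z) as [H|[H|H]]; trivial.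
  + destruct (Lz _ H) as [k Hk]; discriminate (IHc _ _ _ Hy Hk).
  + destruct (Ly _ H) as [k Hk]; discriminate (IHc _ _ _ Hz Hk).
Qed.

Lemma phi_fun (A : cantor_space) (e x y z : nat) :
  phi A e x y -> phi A e x z -> y = z.
Proof.
intros (c & <- & Hy) (d & Hd & Hz).
apply encode_inj in Hd; subst d; exact (eval_fun _ _ _ _ _ Hy Hz).
Qed.

Definition computes (A : cantor_space) (g : nat -> nat) : Prop :=
  exists e, forall n, phi A e n (g n).

Definition turing_le (B A : cantor_space) : Prop :=
  computes A (fun n => Nat.b2n (B n)).

Definition computable_set (R : cantor_space) : Prop := turing_le R empty_set.

Definition jump (A : cantor_space) : cantor_space :=
  fun e => if excluded_middle_informative (exists y, phi A e e y)
           then true else false.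

Definition join (A B : cantor_space) : cantor_space :=
  fun n => if Nat.even n then A (Nat.div2 n) else B (Nat.div2 n).

Definition Sigma02 (X : cantor_space) : Prop :=
  exists R, computable_set R /\
    forall n, X n = true <-> exists a, forall b, R ⟨n, ⟨a, b⟩⟩ = true.

Definition Pi02 (X : cantor_space) : Prop :=
  exists R, computable_set R /\
    forall n, X n = true <-> forall a, exists b, R ⟨n, ⟨a, b⟩⟩ = true.

Definition Delta02 (X : cantor_space) : Prop := Sigma02 X /\ Pi02 X.

Definition DNC_function_rel (A : cantor_space) (g : nat -> nat) : Prop :=
  forall e y, phi A e e y -> g e <> y.

Definition has_DNC_degree_rel (X A : cantor_space) : Prop :=
  exists g, computes X g /\ DNC_function_rel A g.

Definition GL1 (A : cantor_space) : Prop :=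
  turing_le (jump A) (join A (jump empty_set)).

(* Main.v *)
From Stdlib Require Import Arith Bool Lia Cantor ClassicalEpsilon.
Require Import Defs.

(** By Shoenfield's limit lemma the DNC function [g] computed by [X] is the
    pointwise limit of a computable function [L x s].  Let [p e] be an index of
    the [A]-partial recursive function that waits for the least stage [s] at
    which [φ_e^A(e)] halts and then returns [L z s] on input [z].  If
    [φ_e^A(e)] halts at stage [s], then [φ_(p e)^A(p e) = L (p e) s], so [g]
    being DNC forces [g (p e) <> L (p e) s]: the halting stage lies below any
    stage [t] from which on [L (p e)] is constant.  Such a [t] can be found
    with [∅'], and running [φ_e^A(e)] for [t] stages decides [A']. *)

(* Projections of Cantor's pairing *)
Local Opaque Cantor.to_nat Cantor.of_nat.

Definition p1 (z : nat) : nat := fst (Cantor.of_nat z).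
Definition p2 (z : nat) : nat := snd (Cantor.of_nat z).

Lemma p1_pair x y : p1 ⟨x, y⟩ = x.
Proof. unfold p1; now rewrite Cantor.cancel_of_to. Qed.

Lemma p2_pair x y : p2 ⟨x, y⟩ = y.
Proof. unfold p2; now rewrite Cantor.cancel_of_to. Qed.

Lemma pair_eta z : ⟨p1 z, p2 z⟩ = z.
Proof.
unfold p1, p2; rewrite <- surjective_pairing; apply Cantor.cancel_to_of.
Qed.

Ltac simpl_pair := repeat (rewrite p1_pair || rewrite p2_pair).
Ltac simpl_pair_in H := repeat (rewrite p1_pair in H || rewrite p2_pair in H).

(** * Functions recursive in an oracle *)

Definition recursive_in (A : cantor_space) (f : nat -> nat) : Prop :=
  exists c, forall x, eval A c x (f x).

(** Since [encode] is injective, an index determines its program, so the program found at input 0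
    serves every input. *)
Lemma computes_recursive_in A g : computes A g <-> recursive_in A g.
Proof.
split.
- intros [e He]; destruct (He 0) as (c & Hc & _); exists c; intros n.
  destruct (He n) as (d & Hd & Hn); subst e.
  now rewrite <- (encode_inj _ _ Hd).
- intros [c Hc]; exists (encode c); intros n; now exists c.
Qed.

Lemma phi_encode A c x y : phi A (encode c) x y <-> eval A c x y.
Proof.
split.
- intros (d & Hd & H); now rewrite <- (encode_inj _ _ Hd).
- now exists c.
Qed.

Lemma jump_true A e : jump A e = true <-> exists y, phi A e e y.
Proof.
unfold jump; destruct (excluded_middle_informative _); split; easy.
Qed.

Lemma recursive_ext A f g :
  (forall x, f x = g x) -> recursive_in A f -> recursive_in A g.
Proof. intros E [c Hc]; exists c; intros x; rewrite <- E; apply Hc. Qed.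

(** This is the identity because Cantor's pairing is onto: every number is a pair. *)
Definition Id : code := Pair Fst Snd.

Lemma eval_Id A x : eval A Id x x.
Proof.
exists (p1 x), (p2 x); repeat split; symmetry; apply pair_eta.
Qed.

Fixpoint const_code (k : nat) : code :=
  match k with
  | 0 => Zero
  | S k => Comp Succ (const_code k)
  end.

Lemma eval_const_code A k x : eval A (const_code k) x k.
Proof. induction k as [|k IH]; cbn; [easy | now exists k]. Qed.

Lemma recursive_id A : recursive_in A (fun x => x).
Proof. exists Id; apply eval_Id. Qed.

Lemma recursive_const A k : recursive_in A (fun _ => k).
Proof. exists (const_code k); apply eval_const_code. Qed.

Lemma recursive_comp A f g :
  recursive_in A f -> recursive_in A g -> recursive_in A (fun x => f (g x)).
Proof. intros [c Hc] [d Hd]; exists (Comp c d); intros x; now exists (g x). Qed.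

Lemma recursive_pair A f g :
  recursive_in A f -> recursive_in A g -> recursive_in A (fun x => ⟨f x, g x⟩).
Proof.
intros [c Hc] [d Hd]; exists (Pair c d); intros x.
exists (f x), (g x); repeat split; auto.
Qed.

Lemma recursive_S A f : recursive_in A f -> recursive_in A (fun x => S (f x)).
Proof. apply recursive_comp; now exists Succ. Qed.

Lemma recursive_p1 A f : recursive_in A f -> recursive_in A (fun x => p1 (f x)).
Proof. apply recursive_comp; now exists Fst. Qed.

Lemma recursive_p2 A f : recursive_in A f -> recursive_in A (fun x => p2 (f x)).
Proof. apply recursive_comp; now exists Snd. Qed.

Lemma recursive_oracle A f :
  recursive_in A f -> recursive_in A (fun x => Nat.b2n (A (f x))).
Proof.
apply (recursive_comp A (fun x => Nat.b2n (A x))); now exists Oracle.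
Qed.

(** The shape matches [Prec]: [z] itself is kept as the parameter, and the step is assumed recursive
    on the packed triple ⟨z, ⟨m, v⟩⟩ that [Prec] hands to its second program. *)
Lemma recursive_nat_rect A f g n :
  recursive_in A f ->
  recursive_in A (fun w => g (p1 w) (p1 (p2 w)) (p2 (p2 w))) ->
  recursive_in A n ->
  recursive_in A (fun z => nat_rect (fun _ => nat) (f z) (g z) (n z)).
Proof.
intros [c Hc] [d Hd] [b Hb]; exists (Comp (Prec c d) (Pair Id b)); intros z.
exists ⟨z, n z⟩; split.
- exists z, (n z); repeat split; auto using eval_Id.
- cbn [eval]; fold (p1 ⟨z, n z⟩) (p2 ⟨z, n z⟩); simpl_pair.
  generalize (n z) as m; induction m as [|m IH]; cbn; auto.
  eexists; split; [exact IH|].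
  specialize (Hd ⟨z, ⟨m, nat_rect (fun _ => nat) (f z) (g z) m⟩⟩).
  now simpl_pair_in Hd.
Qed.

(** Case distinction is a recursion whose step looks only at the predecessor. *)
Lemma recursive_match A f g n :
  recursive_in A f ->
  recursive_in A (fun w => g (p1 w) (p2 w)) ->
  recursive_in A n ->
  recursive_in A (fun z => match n z with 0 => f z | S m => g z m end).
Proof.
intros Hf Hg Hn.
apply recursive_ext with
  (fun z => nat_rect (fun _ => nat) (f z) (fun m _ => g z m) (n z)).
- intros z; now destruct (n z).
- apply recursive_nat_rect with (g := fun z m _ => g z m); auto.
  refine (recursive_ext _ _ _ _ (recursive_comp _ _
    (fun w => ⟨p1 w, p1 (p2 w)⟩) Hg _)).
  + intros w; cbn beta; now simpl_pair.
  + auto using recursive_pair, recursive_p1, recursive_p2, recursive_id.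
Qed.

Lemma recursive_add A f g :
  recursive_in A f -> recursive_in A g -> recursive_in A (fun x => f x + g x).
Proof.
intros Hf Hg.
apply recursive_ext with
  (fun z => nat_rect (fun _ => nat) (f z) (fun _ v => S v) (g z)).
- intros z; induction (g z) as [|m IH]; cbn; lia.
- apply recursive_nat_rect with (g := fun _ _ v => S v);
    auto using recursive_S, recursive_p2, recursive_id.
Qed.

Lemma recursive_sub A f g :
  recursive_in A f -> recursive_in A g -> recursive_in A (fun x => f x - g x).
Proof.
intros Hf Hg.
apply recursive_ext with
  (* Truncated subtraction iterates the predecessor. *)
  (fun z => nat_rect (fun _ => nat) (f z)
              (fun _ v => match v with 0 => 0 | S u => u end) (g z)).
- intros z; induction (g z) as [|m IH]; cbn; [lia|].
  rewrite IH; destruct (f z - m) eqn:E; lia.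
- apply recursive_nat_rect
    with (g := fun _ _ v => match v with 0 => 0 | S u => u end); auto.
  apply recursive_match with (f := fun _ => 0) (g := fun _ u => u);
    auto using recursive_const, recursive_p2, recursive_id.
Qed.

(** * Bounded and unbounded search *)

Definition first_zero (f : nat -> nat) (s : nat) : nat :=
  nat_rect (fun _ => nat) 0
    (fun _ r => match f r with 0 => r | S _ => S r end) s.

(** The counter moves only past nonzero values, so it sticks at the first zero and has the default
    value [s] when there is none below [s]. *)
Lemma first_zero_spec f s :
  first_zero f s <= s /\
  (forall m, m < first_zero f s -> f m <> 0) /\
  (first_zero f s < s -> f (first_zero f s) = 0).
Proof.
induction s as [|s (IH1 & IH2 & IH3)].
- cbn; repeat split; lia.
- change (first_zero f (S s)) with (match f (first_zero f s) with
    0 => first_zero f s | S _ => S (first_zero f s) end).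
  destruct (f (first_zero f s)) as [|k] eqn:E.
  + repeat split; auto.
  + repeat split.
    * lia.
    * intros m Hm; destruct (Nat.eq_dec m (first_zero f s)) as [->|]; [lia|].
      apply IH2; lia.
    * intros H; exfalso; lia.
Qed.

Lemma first_zero_eq f s n :
  n < s -> f n = 0 -> (forall m, m < n -> f m <> 0) -> first_zero f s = n.
Proof.
intros Hn Hf Hm; destruct (first_zero_spec f s) as (H1 & H2 & H3).
destruct (Nat.lt_trichotomy (first_zero f s) n) as [H|[H|H]]; trivial.
- destruct (Hm _ H); apply H3; lia.
- now destruct (H2 _ H).
Qed.

(** Turns a bounded universal statement into an arithmetic test, which stays within the recursive
    functions. *)
Lemma first_zero_none f s :
  s - first_zero f s = 0 <-> forall m, m < s -> f m <> 0.
Proof.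
destruct (first_zero_spec f s) as (H1 & H2 & H3); split.
- intros H m Hm; apply H2; lia.
- intros H; destruct (Nat.lt_ge_cases (first_zero f s) s) as [L|L]; [|lia].
  now destruct (H _ L); apply H3.
Qed.

Lemma recursive_first_zero A f s :
  recursive_in A (fun w => f (p1 w) (p2 w)) ->
  recursive_in A s ->
  recursive_in A (fun z => first_zero (f z) (s z)).
Proof.
intros Hf Hs.
apply (recursive_nat_rect A (fun _ => 0)
  (fun z _ r => match f z r with 0 => r | S _ => S r end)); trivial.
- apply recursive_const.
- apply (recursive_match A (fun w => p2 (p2 w)) (fun w _ => S (p2 (p2 w)))).
  + auto using recursive_p2, recursive_id.
  + auto using recursive_S, recursive_p1, recursive_p2, recursive_id.
  + refine (recursive_ext _ _ _ _ (recursive_comp _ _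
      (fun w => ⟨p1 w, p2 (p2 w)⟩) Hf _)).
    * intros w; cbn beta; now simpl_pair.
    * auto using recursive_pair, recursive_p1, recursive_p2, recursive_id.
Qed.

Lemma eval_Mu A c h :
  (forall z, eval A c z (h z)) -> forall x n,
  eval A (Mu c) x n <->
  h ⟨x, n⟩ = 0 /\ forall m, m < n -> h ⟨x, m⟩ <> 0.
Proof.
intros Hc x n; cbn [eval]; split; intros [H1 H2]; split.
- apply (eval_fun A c ⟨x, n⟩); auto.
- intros m Hm; destruct (H2 m Hm) as [k Hk].
  now rewrite (eval_fun A c _ _ _ (Hc _) Hk).
- rewrite <- H1; apply Hc.
- intros m Hm; exists (Nat.pred (h ⟨x, m⟩)); specialize (H2 m Hm).
  rewrite Nat.succ_pred by trivial; apply Hc.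
Qed.

Lemma least_zero (f : nat -> nat) n :
  f n = 0 -> exists m, f m = 0 /\ forall k, k < m -> f k <> 0.
Proof.
intros Hn; destruct (first_zero_spec f (S n)) as (H1 & H2 & H3).
exists (first_zero f (S n)); split; trivial.
destruct (Nat.eq_dec (first_zero f (S n)) (S n)) as [E|E]; [|apply H3; lia].
exfalso; apply (H2 n); lia.
Qed.

(** [T] is chosen among the values of [Mu c]; each chosen value carries its own evaluation, so
    [Mu c] computes [T]. *)
Lemma recursive_search A (h : nat -> nat -> nat) :
  recursive_in A (fun z => h (p1 z) (p2 z)) ->
  (forall x, exists n, h x n = 0) ->
  exists T, recursive_in A T /\ forall x, h x (T x) = 0.
Proof.
intros [c Hc] Hex.
assert (Hl : forall x, exists n, eval A (Mu c) x n /\ h x n = 0).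
{ intros x; destruct (Hex x) as [n0 Hn0].
  destruct (least_zero (h x) n0 Hn0) as (n & Hn & Hm).
  exists n; split; trivial; apply (eval_Mu A c _ Hc); simpl_pair.
  split; trivial; intros m Lm; simpl_pair; auto. }
exists (fun x => proj1_sig (constructive_indefinite_description _ (Hl x))).
split.
- exists (Mu c); intros x.
  now destruct (constructive_indefinite_description _ (Hl x)).
- intros x; now destruct (constructive_indefinite_description _ (Hl x)).
Qed.

(** * Change of oracle and joins *)

Fixpoint subst_oracle (d c : code) : code :=
  match c with
  | Oracle => d
  | Pair c c' => Pair (subst_oracle d c) (subst_oracle d c')
  | Comp c c' => Comp (subst_oracle d c) (subst_oracle d c')
  | Prec c c' => Prec (subst_oracle d c) (subst_oracle d c')
  | Mu c => Mu (subst_oracle d c)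
  | c => c
  end.

Lemma eval_subst_oracle A B d :
  (forall x, eval B d x (Nat.b2n (A x))) ->
  forall c x y, eval A c x y -> eval B (subst_oracle d c) x y.
Proof.
intros Hd c;
  induction c as [| | | | |c IHc c' IHc'|c IHc c' IHc'|c IHc c' IHc'|c IHc];
  intros x y; cbn [subst_oracle eval]; trivial.
- now intros ->.
- intros (u & v & Hu & Hv & ->); exists u, v; auto.
- intros (u & Hu & Hy); exists u; auto.
- generalize (fst (Cantor.of_nat x)) (snd (Cantor.of_nat x)); intros a n.
  revert y; induction n as [|n IHn]; cbn; auto.
  intros y (v & Hv & Hy); exists v; auto.
- intros [H1 H2]; split; auto.
  intros m Hm; destruct (H2 m Hm) as [k Hk]; exists k; auto.
Qed.

Lemma recursive_in_trans A B f :
  recursive_in B (fun x => Nat.b2n (A x)) ->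
  recursive_in A f -> recursive_in B f.
Proof.
intros [d Hd] [c Hc]; exists (subst_oracle d c); intros x.
now apply (eval_subst_oracle A B).
Qed.

Lemma recursive_in_empty_set A f : recursive_in empty_set f -> recursive_in A f.
(* Answers of the empty oracle reduce to 0, so a constant program provides them. *)
Proof. exact (recursive_in_trans empty_set A f (recursive_const A 0)). Qed.

Lemma recursive_join_l A B : recursive_in (join A B) (fun x => Nat.b2n (A x)).
Proof.
apply recursive_ext with (fun x => Nat.b2n (join A B (x + x))).
- intros x; unfold join; replace (x + x) with (2 * x) by lia.
  now rewrite Nat.even_even, Nat.div2_double.
- auto using recursive_oracle, recursive_add, recursive_id.
Qed.

Lemma recursive_join_r A B : recursive_in (join A B) (fun x => Nat.b2n (B x)).
Proof.
apply recursive_ext with (fun x => Nat.b2n (join A B (S (x + x)))).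
- intros x; unfold join; replace (S (x + x)) with (S (2 * x)) by lia.
  rewrite Nat.div2_succ_double.
  now replace (S (2 * x)) with (2 * x + 1) by lia; rewrite Nat.even_odd.
- auto using recursive_oracle, recursive_S, recursive_add, recursive_id.
Qed.

(** Proves recursiveness by recursion on the body of the function. A binary function known through
    its packed form is applied by composing with a pair; goals that match no rule are left open. *)
Ltac solve_recursive :=
  cbn beta;
  lazymatch goal with
  | H : recursive_in ?A ?f |- recursive_in ?A ?f => exact H
  | |- recursive_in _ (fun x => x) => apply recursive_id
  | |- recursive_in _ (fun _ => ?k) => apply recursive_const
  | |- recursive_in ?A (fun x => match @?n x with 0 => @?f x | S m => @?g x m end) =>
      apply (recursive_match A f g n); solve_recursive
  | |- recursive_in ?A (fun x => Cantor.to_nat (@?f x, @?g x)) =>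
      apply (recursive_pair A f g); solve_recursive
  | |- recursive_in ?A (fun x => S (@?f x)) =>
      apply (recursive_S A f); solve_recursive
  | |- recursive_in ?A (fun x => p1 (@?f x)) =>
      apply (recursive_p1 A f); solve_recursive
  | |- recursive_in ?A (fun x => p2 (@?f x)) =>
      apply (recursive_p2 A f); solve_recursive
  | |- recursive_in ?A (fun x => Nat.b2n (?A (@?f x))) =>
      apply (recursive_oracle A f); solve_recursive
  | |- recursive_in ?A (fun x => @?f x + @?g x) =>
      apply (recursive_add A f g); solve_recursive
  | |- recursive_in ?A (fun x => @?f x - @?g x) =>
      apply (recursive_sub A f g); solve_recursive
  | |- recursive_in ?A (fun x => first_zero (@?f x) (@?s x)) =>
      apply (recursive_first_zero A f s); solve_recursive
  | |- recursive_in ?A (fun x => nat_rect (fun _ => nat) (@?f x) (@?g x) (@?n x)) =>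
      apply (recursive_nat_rect A f g n); solve_recursive
  | H : recursive_in ?A (fun z => ?h (p1 z) (p2 z))
    |- recursive_in ?A (fun x => ?h (@?f x) (@?g x)) =>
      apply (recursive_ext A (fun x => (fun z => h (p1 z) (p2 z)) ⟨f x, g x⟩));
      [intros ?; cbn beta; now simpl_pair|];
      apply (recursive_comp A _ (fun x => ⟨f x, g x⟩) H); solve_recursive
  | H : recursive_in ?A (fun z => Nat.b2n (?h z))
    |- recursive_in ?A (fun x => Nat.b2n (?h (@?f x))) =>
      apply (recursive_comp A (fun z => Nat.b2n (h z)) f H); solve_recursive
  | H : recursive_in ?A ?h |- recursive_in ?A (fun x => ?h (@?f x)) =>
      apply (recursive_comp A h f H); solve_recursive
  | _ => idtac
  end.

(** * The s-m-n theorem *)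

Definition smn_code (q : code) (k : nat) : code :=
  Comp q (Pair (const_code k) Id).

Lemma eval_smn_code A q k x y :
  eval A (smn_code q k) x y <-> eval A q ⟨k, x⟩ y.
Proof.
unfold smn_code; change (eval A (Comp q (Pair (const_code k) Id)) x y) with
  (exists u, eval A (Pair (const_code k) Id) x u /\ eval A q u y).
assert (H : eval A (Pair (const_code k) Id) x ⟨k, x⟩)
  by (exists k, x; auto using eval_const_code, eval_Id).
split.
- intros (u & Hu & Hy); now rewrite (eval_fun _ _ _ _ _ H Hu).
- now exists ⟨k, x⟩.
Qed.

(** Indices of constant programs obey a primitive recursion: each successor wraps the previous index
    under tag 6, that of [Comp]. The rest is a fixed arrangement of pairs. *)
Lemma recursive_smn A q : recursive_in A (fun k => encode (smn_code q k)).
Proof.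
assert (recursive_in A (fun k => encode (const_code k))).
{ apply recursive_ext with (fun k => nat_rect (fun _ => nat) (encode Zero)
    (fun _ v => ⟨6, ⟨encode Succ, v⟩⟩) k).
  - intros k; induction k as [|k IH]; [easy|].
    cbn [const_code encode]; now rewrite <- IH.
  - solve_recursive. }
apply recursive_ext with
  (fun k => ⟨6, ⟨encode q, ⟨5, ⟨encode (const_code k), encode Id⟩⟩⟩⟩).
- easy.
- solve_recursive.
Qed.

(** * A universal machine *)

(** The successor separates nonempty stacks from the empty stack 0. *)
Definition push (t K : nat) : nat := S ⟨t, K⟩.

(* One step of a stack machine with current value [v] and topmost task
   [⟨tag, d⟩].  Tags 0 to 8 are those of [encode], so that a program is itself
   the task of running it on the current value.  Task 9 checks that [d] encodes
   a program, and gets stuck otherwise; tasks 10 and 11 finish a [Pair], task 12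
   a recursion step of [Prec], and task 13 a test of [Mu]. *)
Definition exec (A : cantor_space) (v tag d K : nat) : nat :=
  match tag with
  | 0 => ⟨0, K⟩
  | 1 => ⟨S v, K⟩
  | 2 => ⟨p1 v, K⟩
  | 3 => ⟨p2 v, K⟩
  | 4 => ⟨Nat.b2n (A v), K⟩
  | 5 => ⟨v, push (p1 d) (push ⟨10, ⟨p2 d, v⟩⟩ K)⟩
  | 6 => ⟨v, push (p2 d) (push (p1 d) K)⟩
  | 7 => match p2 v with
         | 0 => ⟨p1 v, push (p1 d) K⟩
         | S m => ⟨⟨p1 v, m⟩,
                   push ⟨7, d⟩ (push ⟨12, ⟨p2 d, ⟨p1 v, m⟩⟩⟩ K)⟩
         end
  | 8 => ⟨⟨v, 0⟩, push d (push ⟨13, ⟨d, ⟨v, 0⟩⟩⟩ K)⟩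
  | 9 => match p1 d with
         | 0 | 1 | 2 | 3 | 4 =>
             match p2 d with
             | 0 => ⟨v, K⟩
             | S _ => ⟨v, push ⟨9, d⟩ K⟩
             end
         | 5 | 6 | 7 =>
             ⟨v, push ⟨9, p1 (p2 d)⟩ (push ⟨9, p2 (p2 d)⟩ K)⟩
         | 8 => ⟨v, push ⟨9, p2 d⟩ K⟩
         | _ => ⟨v, push ⟨9, d⟩ K⟩
         end
  | 10 => ⟨p2 d, push (p1 d) (push ⟨11, v⟩ K)⟩
  | 11 => ⟨⟨d, v⟩, K⟩
  | 12 => ⟨⟨p1 (p2 d), ⟨p2 (p2 d), v⟩⟩, push (p1 d) K⟩
  | _ => match v with
         | 0 => ⟨p2 (p2 d), K⟩
         | S _ => ⟨⟨p1 (p2 d), S (p2 (p2 d))⟩,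
                   push (p1 d)
                     (push ⟨13, ⟨p1 d, ⟨p1 (p2 d), S (p2 (p2 d))⟩⟩⟩ K)⟩
         end
  end.

(** A state is ⟨value, stack⟩. States with empty stack are fixed points, which makes halting
    monotone in the number of steps. *)
Definition step (A : cantor_space) (s : nat) : nat :=
  match p2 s with
  | 0 => s
  | S k => exec A (p1 s) (p1 (p1 k)) (p2 (p1 k)) (p2 k)
  end.

Lemma step_push A v tag d K :
  step A ⟨v, push ⟨tag, d⟩ K⟩ = exec A v tag d K.
Proof. unfold step; simpl_pair; unfold push; now simpl_pair. Qed.

Lemma recursive_step A : recursive_in A (step A).
Proof.
change (recursive_in A (fun s => step A s)).
unfold step, exec, push; solve_recursive.
Qed.

Definition halts (A : cantor_space) (n s : nat) : Prop :=
  p2 (Nat.iter n (step A) s) = 0.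

Lemma halts_S A n s : halts A (S n) s <-> halts A n (step A s).
Proof. unfold halts; now rewrite Nat.iter_succ_r. Qed.

Lemma halts_0_push A v t K : ~ halts A 0 ⟨v, push t K⟩.
Proof. unfold halts, push; cbn; now rewrite p2_pair. Qed.

Lemma halts_push A n v tag d K :
  halts A n ⟨v, push ⟨tag, d⟩ K⟩ ->
  exists m, n = S m /\ halts A m (exec A v tag d K).
Proof.
destruct n as [|n]; [intros H; now apply halts_0_push in H|].
rewrite halts_S, step_push; eauto.
Qed.

Lemma halts_mono A m n s : m <= n -> halts A m s -> halts A n s.
Proof.
induction 1 as [|n _ IH]; trivial; intros H; specialize (IH H).
unfold halts in *; rewrite Nat.iter_succ; revert IH.
generalize (Nat.iter n (step A) s) as u; intros u Hu.
unfold step; now rewrite Hu.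
Qed.

Definition reaches (A : cantor_space) (s t : nat) : Prop :=
  exists n, Nat.iter n (step A) s = t.

Lemma reaches_refl A s : reaches A s s.
Proof. now exists 0. Qed.

Lemma reaches_trans A s t u : reaches A s t -> reaches A t u -> reaches A s u.
Proof.
intros [m <-] [n <-]; exists (n + m); now rewrite Nat.iter_add.
Qed.

Lemma reaches_push A v tag d K t :
  reaches A (exec A v tag d K) t -> reaches A ⟨v, push ⟨tag, d⟩ K⟩ t.
Proof.
intros [n Hn]; exists (S n); now rewrite Nat.iter_succ_r, step_push.
Qed.

Ltac run := apply reaches_push; cbn [exec]; simpl_pair.

(** Induction on the program with [K] arbitrary, because subprograms run on top of pending tasks. *)
Lemma run_complete A c x y :
  eval A c x y -> forall K, reaches A ⟨x, push (encode c) K⟩ ⟨y, K⟩.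
Proof.
revert x y;
  induction c as [| | | | |c IHc d IHd|c IHc d IHd|c IHc d IHd|c IHc];
  cbn [eval encode]; intros x y.
- intros -> K; run; apply reaches_refl.
- intros -> K; run; apply reaches_refl.
- intros -> K; run; apply reaches_refl.
- intros -> K; run; apply reaches_refl.
- intros -> K; run; apply reaches_refl.
- intros (u & v & Hu & Hv & ->) K; run.
  apply (reaches_trans _ _ _ _ (IHc _ _ Hu _)); run.
  apply (reaches_trans _ _ _ _ (IHd _ _ Hv _)); run.
  apply reaches_refl.
- intros (u & Hu & Hy) K; run.
  apply (reaches_trans _ _ _ _ (IHd _ _ Hu _)), (IHc _ _ Hy).
- fold (p1 x) (p2 x); intros H K; rewrite <- (pair_eta x); revert y H K.
  generalize (p1 x) (p2 x); clear x; intros x n.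
  induction n as [|n IHn]; cbn [prec_graph]; intros y.
  + intros Hy K; run; now apply IHc.
  + intros (v & Hv & Hy) K; run.
    apply (reaches_trans _ _ _ _ (IHn _ Hv _)); run.
    apply (IHd _ _ Hy).
- intros [Hy Hm] K; run.
  (* Loop invariant of [Mu]: before the test of [m], task 13 remembers ⟨x, m⟩ below the run of
     [c]. *)
  assert (H : forall m, m <= y ->
    reaches A ⟨⟨x, 0⟩, push (encode c) (push ⟨13, ⟨encode c, ⟨x, 0⟩⟩⟩ K)⟩
              ⟨⟨x, m⟩, push (encode c) (push ⟨13, ⟨encode c, ⟨x, m⟩⟩⟩ K)⟩).
  { induction m as [|m IHm]; intros L; [apply reaches_refl|].
    apply (reaches_trans _ _ _ _ (IHm (Nat.lt_le_incl _ _ L))).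
    destruct (Hm m L) as [k Hk].
    apply (reaches_trans _ _ _ _ (IHc _ _ Hk _)); run; apply reaches_refl. }
  apply (reaches_trans _ _ _ _ (H y (le_n y))).
  apply (reaches_trans _ _ _ _ (IHc _ _ Hy _)); run; apply reaches_refl.
Qed.

(** Induction on the program. The bound [m <= n] lets the [Mu] case recurse on the number of
    remaining steps, since the structure of the program does not limit the length of its loop. *)
Lemma run_sound A c n x K :
  halts A n ⟨x, push (encode c) K⟩ ->
  exists y m, m <= n /\ eval A c x y /\ halts A m ⟨y, K⟩.
Proof.
revert n x K;
  induction c as [| | | | |c IHc d IHd|c IHc d IHd|c IHc d IHd|c IHc];
  cbn [encode]; intros n x K H;
  apply halts_push in H as (n1 & -> & H); cbn [exec] in H; simpl_pair_in H.
1-5: eexists _, n1; split; [lia|]; split; [|exact H]; reflexivity.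
- apply IHc in H as (u & n2 & L2 & Hu & H).
  apply halts_push in H as (n3 & -> & H); cbn [exec] in H; simpl_pair_in H.
  apply IHd in H as (v & n4 & L4 & Hv & H).
  apply halts_push in H as (n5 & -> & H); cbn [exec] in H.
  exists ⟨u, v⟩, n5; split; [lia|]; split; trivial.
  exists u, v; auto.
- apply IHd in H as (u & n2 & L2 & Hu & H).
  apply IHc in H as (y & n4 & L4 & Hy & H).
  exists y, n4; split; [lia|]; split; trivial; now exists u.
- cbn [eval]; fold (p1 x) (p2 x).
  revert H; generalize (p1 x) (p2 x); clear x; intros x k; revert n1 K.
  induction k as [|k IHk]; intros n1 K H; cbn [prec_graph].
  + apply IHc in H as (y & n2 & L2 & Hy & H); exists y, n2; auto.
  + apply halts_push in H as (n2 & -> & H); cbn [exec] in H; simpl_pair_in H.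
    apply IHk in H as (v & n3 & L3 & Hv & H).
    apply halts_push in H as (n4 & -> & H); cbn [exec] in H; simpl_pair_in H.
    apply IHd in H as (y & n5 & L5 & Hy & H).
    exists y, n5; split; [lia|]; split; trivial; now exists v.
(* The start 0 of the search is generalized to any [a], so that the induction on steps covers later
   rounds. *)
- enough (Hloop : forall n a,
    halts A n ⟨⟨x, a⟩, push (encode c) (push ⟨13, ⟨encode c, ⟨x, a⟩⟩⟩ K)⟩ ->
    exists y m, m <= n /\ (eval A c ⟨x, y⟩ 0 /\
      forall i, a <= i < y -> exists k, eval A c ⟨x, i⟩ (S k)) /\
      halts A m ⟨y, K⟩).
  { apply Hloop in H as (y & m & L & [H1 H2] & H3); exists y, m.
    split; [lia|]; split; trivial; split; trivial.
    intros i Hi; apply H2; lia. }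
  clear n1 H; intros n1.
  induction n1 as [n1 IHn] using (well_founded_induction lt_wf); intros a H.
  apply IHc in H as (v & n2 & L2 & Hv & H).
  apply halts_push in H as (n3 & -> & H); cbn [exec] in H.
  destruct v as [|v]; simpl_pair_in H.
  + exists a, n3; split; [lia|]; split; trivial; split; trivial; lia.
  + apply IHn in H as (y & m & L & [H1 H2] & H3); [|lia].
    exists y, m; split; [lia|]; split; trivial; split; trivial.
    intros i Hi; destruct (Nat.eq_dec i a) as [->|]; [eauto|apply H2; lia].
Qed.

Lemma check_complete A c v K :
  reaches A ⟨v, push ⟨9, encode c⟩ K⟩ ⟨v, K⟩.
Proof.
revert K; induction c as [| | | | |c IHc d IHd|c IHc d IHd|c IHc d IHd|c IHc];
  cbn [encode]; intros K; run.
1-5: apply reaches_refl.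
1-3: apply (reaches_trans _ _ _ _ (IHc _)), IHd.
apply IHc.
Qed.

(** Induction on the number of steps: a stuck check restores its own task, so a halting run from
    there is a shorter run of the same check. *)
Lemma check_sound A n e v K :
  halts A n ⟨v, push ⟨9, e⟩ K⟩ ->
  exists c m, m <= n /\ e = encode c /\ halts A m ⟨v, K⟩.
Proof.
revert e K; induction n as [n IH] using (well_founded_induction lt_wf).
intros e K H; apply halts_push in H as (n1 & -> & H); cbn [exec] in H.
assert (Hstuck : halts A n1 ⟨v, push ⟨9, e⟩ K⟩ ->
  exists c m, m <= S n1 /\ e = encode c /\ halts A m ⟨v, K⟩).
{ intros Hs; apply IH in Hs as (c & m & L & E & Hm); [|lia].
  exists c, m; auto. }
assert (Hbin : forall f : code -> code -> code,
  (forall c d, encode (f c d) = ⟨p1 e, ⟨encode c, encode d⟩⟩) ->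
  halts A n1 ⟨v, push ⟨9, p1 (p2 e)⟩ (push ⟨9, p2 (p2 e)⟩ K)⟩ ->
  exists c m, m <= S n1 /\ e = encode c /\ halts A m ⟨v, K⟩).
{ intros f Hf Hs; apply IH in Hs as (c & m & L & Ec & Hm); [|lia].
  apply IH in Hm as (d & m' & L' & Ed & Hm); [|lia].
  exists (f c d), m'; split; [lia|]; split; trivial.
  now rewrite Hf, <- Ec, <- Ed, !pair_eta. }
assert (Hbase : forall c, encode c = ⟨p1 e, 0⟩ ->
  halts A n1 (match p2 e with 0 => ⟨v, K⟩ | S _ => ⟨v, push ⟨9, e⟩ K⟩ end) ->
  exists c m, m <= S n1 /\ e = encode c /\ halts A m ⟨v, K⟩).
{ intros c Hc; destruct (p2 e) eqn:E2; [|exact Hstuck].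
  intros Hs; exists c, n1; rewrite Hc, <- E2, pair_eta; auto. }
destruct (p1 e) as [|[|[|[|[|[|[|[|[|t]]]]]]]]] eqn:E1.
- now apply (Hbase Zero).
- now apply (Hbase Succ).
- now apply (Hbase Fst).
- now apply (Hbase Snd).
- now apply (Hbase Oracle).
- now apply (Hbin Pair).
- now apply (Hbin Comp).
- now apply (Hbin Prec).
- apply IH in H as (c & m & L & Ec & Hm); [|lia].
  exists (Mu c), m; split; [lia|]; split; trivial.
  cbn [encode]; now rewrite <- Ec, <- E1, pair_eta.
- exact (Hstuck H).
Qed.

(** The check comes first because [exec] can also halt on numbers that encode no program, where
    [phi] is undefined. *)
Definition diagonal_start (e : nat) : nat := ⟨e, push ⟨9, e⟩ (push e 0)⟩.

Lemma jump_iff_halts A e :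
  jump A e = true <-> exists n, halts A n (diagonal_start e).
Proof.
rewrite jump_true; unfold diagonal_start; split.
- intros (y & c & <- & Hy).
  destruct (reaches_trans _ _ _ _ (check_complete A c _ _)
    (run_complete A c _ _ Hy 0)) as [n Hn].
  exists n; unfold halts; now rewrite Hn, p2_pair.
- intros [n H]; apply check_sound in H as (c & m & _ & Ec & H).
  (* Only the task is rewritten to [encode c]; the input stays [e]. *)
  rewrite Ec in H at 2; apply run_sound in H as (y & _ & _ & Hy & _).
  exists y, c; auto.
Qed.

Lemma recursive_halting_stage A :
  exists h : nat -> nat -> nat,
    recursive_in A (fun z => h (p1 z) (p2 z)) /\
    (forall e, jump A e = true <-> exists n, h e n = 0) /\
    (forall e m n, m <= n -> h e m = 0 -> h e n = 0).
Proof.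
(* [h e n] is the stack left after [n] steps, which is 0 exactly when the machine has halted. *)
exists (fun e n => p2 (nat_rect (fun _ => nat) (diagonal_start e)
                         (fun _ => step A) n)).
repeat split.
- unfold diagonal_start, push; pose proof (recursive_step A); solve_recursive.
- apply jump_iff_halts.
- apply jump_iff_halts.
- intros e m n L; exact (halts_mono A m n (diagonal_start e) L).
Qed.

(** * The limit lemma *)

Definition eventually (P : nat -> Prop) : Prop :=
  exists t, forall s, t <= s -> P s.

Lemma eventually_ge n : eventually (fun s => n <= s).
Proof. now exists n. Qed.

Lemma eventually_and P Q :
  eventually P -> eventually Q -> eventually (fun s => P s /\ Q s).
Proof.
intros [t Ht] [u Hu]; exists (t + u); intros s L; split;
  [apply Ht | apply Hu]; lia.
Qed.

Lemma eventually_impl (P Q : nat -> Prop) :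
  (forall s, P s -> Q s) -> eventually P -> eventually Q.
Proof. intros H [t Ht]; exists t; auto. Qed.

Lemma eventually_forall_lt (P : nat -> nat -> Prop) n :
  (forall m, m < n -> eventually (P m)) ->
  eventually (fun s => forall m, m < n -> P m s).
Proof.
induction n as [|n IH]; intros H.
- exists 0; lia.
- apply (eventually_impl (fun s => (forall m, m < n -> P m s) /\ P n s)).
  + intros s [H1 H2] m Hm; destruct (Nat.eq_dec m n) as [->|]; trivial.
    apply H1; lia.
  + apply eventually_and; auto.
Qed.

Definition limit_of (L : nat -> nat -> nat) (g : nat -> nat) : Prop :=
  forall x, eventually (fun s => L x s = g x).

(** Every [n] has a true Sigma witness or a true Pi counterexample. Candidates that are neither get
    refuted at some stage, so the least unrefuted candidate converges to the least true one, and its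
    kind tells the value of [X n]. *)
Lemma Delta02_limit X :
  Delta02 X -> exists L,
    recursive_in empty_set (fun z => L (p1 z) (p2 z)) /\
    limit_of L (fun n => Nat.b2n (X n)).
Proof.
intros [(R & HR & HS) (Q & HQ & HP)].
apply computes_recursive_in in HR, HQ.
set (r := fun n s a =>
  s - first_zero (fun b => Nat.b2n (R ⟨n, ⟨a, b⟩⟩)) s).
set (q := fun n s a =>
  s - first_zero (fun b =>
        match Nat.b2n (Q ⟨n, ⟨a, b⟩⟩) with 0 => 1 | S _ => 0 end) s).
(* [r n s a = 0] says that [a] still looks, below [s], like a witness of the
   Sigma definition of [X n], and [q n s a = 0] that it looks like a
   counterexample to the Pi definition. *)
set (W := fun n s => first_zero
  (fun a => match r n s a with 0 => 0 | S _ => q n s a end) s).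
exists (fun n s => match r n s (W n s) with 0 => 1 | S _ => 0 end); split.
{ unfold W, r, q; solve_recursive. }
assert (Hr : forall n s a,
  r n s a = 0 <-> forall b, b < s -> R ⟨n, ⟨a, b⟩⟩ = true).
{ intros n s a; unfold r; rewrite first_zero_none.
  split; intros H b Hb; specialize (H b Hb); destruct (R _); cbn in *; easy. }
assert (Hq : forall n s a,
  q n s a = 0 <-> forall b, b < s -> Q ⟨n, ⟨a, b⟩⟩ = false).
{ intros n s a; unfold q; rewrite first_zero_none.
  split; intros H b Hb; specialize (H b Hb); destruct (Q _); cbn in *; easy. }
intros n.
set (G := fun a => (forall b, R ⟨n, ⟨a, b⟩⟩ = true) \/
                   (forall b, Q ⟨n, ⟨a, b⟩⟩ = false)).
assert (Hr' : forall a, ~ (forall b, R ⟨n, ⟨a, b⟩⟩ = true) ->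
  eventually (fun s => r n s a <> 0)).
{ intros a Ha; apply not_all_ex_not in Ha as [b Hb].
  exists (S b); intros s Hs Hs'; now apply Hb, (Hr n s). }
assert (Hq' : forall a, ~ (forall b, Q ⟨n, ⟨a, b⟩⟩ = false) ->
  eventually (fun s => q n s a <> 0)).
{ intros a Ha; apply not_all_ex_not in Ha as [b Hb].
  exists (S b); intros s Hs Hs'; now apply Hb, (Hq n s). }
(* The Sigma form gives a witness when [X n] is true, the Pi form a counterexample when it is
   false. *)
assert (HG : exists a, G a).
{ destruct (X n) eqn:E.
  - apply HS in E as [a Ha]; exists a; now left.
  - apply NNPP; intros Hno; apply not_true_iff_false in E; apply E, HP.
    intros a; apply NNPP; intros Ha; apply Hno; exists a; right; intros b.
    apply not_true_iff_false; intros Hb; apply Ha; now exists b. }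
assert (HG' : exists a, G a /\ forall a', a' < a -> ~ G a').
{ destruct HG as [a0 Ha0]; revert Ha0.
  induction a0 as [a0 IH] using (well_founded_induction lt_wf); intros Ha0.
  destruct (classic (exists a', a' < a0 /\ G a')) as [(a' & L & Ha')|Hno].
  - exact (IH a' L Ha').
  - exists a0; split; trivial; intros a' L Ha'; apply Hno; now exists a'. }
destruct HG' as (a & Ha & Hmin).
assert (HW : eventually (fun s => W n s = a)).
(* [S a <= s] puts [a] strictly below the search bound; otherwise the default value [s] could be
   returned. *)
{ apply (eventually_impl (fun s => (forall a', a' < a ->
    r n s a' <> 0 /\ q n s a' <> 0) /\ S a <= s)).
  - intros s [H1 H2]; apply first_zero_eq; trivial.
    + destruct (r n s a) eqn:E; trivial; destruct Ha as [Ha|Ha].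
      * rewrite (proj2 (Hr n s a)) in E; easy.
      * apply Hq; auto.
    + intros a' L; destruct (H1 a' L) as [H3 H4]; now destruct (r n s a').
  - apply eventually_and; [|apply eventually_ge].
    apply eventually_forall_lt; intros a' L; specialize (Hmin a' L).
    apply eventually_and; [apply Hr' | apply Hq'];
      intros H; apply Hmin; [now left | now right]. }
destruct (X n) eqn:E; cbn [Nat.b2n].
- revert HW; apply eventually_impl; intros s ->.
  enough (r n s a = 0) as -> by easy.
  apply Hr; intros b _; destruct Ha as [Ha|Ha]; [apply Ha|].
  destruct (proj1 (HP n) E a) as [b' Hb']; now rewrite Ha in Hb'.
- assert (Ha' : ~ (forall b, R ⟨n, ⟨a, b⟩⟩ = true)).
  { intros H; apply not_true_iff_false in E; apply E, HS; now exists a. }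
  apply Hr' in Ha'; generalize (eventually_and _ _ HW Ha').
  apply eventually_impl; intros s [-> H]; now destruct (r n s a).
Qed.

(** Stage [s] answers oracle queries by [LX] and cuts every [Mu] search at [s], so [L] is total. A
    halting computation makes finitely many queries and searches, and all of them are correct from
    some stage on. *)
Lemma eval_limit X LX :
  recursive_in empty_set (fun z => LX (p1 z) (p2 z)) ->
  limit_of LX (fun n => Nat.b2n (X n)) ->
  forall c, exists L,
    recursive_in empty_set (fun z => L (p1 z) (p2 z)) /\
    forall x y, eval X c x y -> eventually (fun s => L x s = y).
Proof.
intros HLX LimX c.
assert (Hcst : forall y, eventually (fun _ => y = y :> nat)) by now exists 0.
induction c as [| | | | |c (L & HL & IHc) d (M & HM & IHd)
  |c (L & HL & IHc) d (M & HM & IHd)|c (L & HL & IHc) d (M & HM & IHd)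
  |c (L & HL & IHc)].
- exists (fun _ _ => 0); split; [solve_recursive|intros x y ->; apply Hcst].
- exists (fun x _ => S x); split; [solve_recursive|intros x y ->; apply Hcst].
- exists (fun x _ => p1 x); split; [solve_recursive|intros x y ->; apply Hcst].
- exists (fun x _ => p2 x); split; [solve_recursive|intros x y ->; apply Hcst].
- exists LX; split; [trivial|intros x y ->; apply LimX].
- exists (fun x s => ⟨L x s, M x s⟩); split; [solve_recursive|].
  intros x y (u & v & Hu & Hv & ->).
  generalize (eventually_and _ _ (IHc _ _ Hu) (IHd _ _ Hv)).
  apply eventually_impl; now intros s [-> ->].
- exists (fun x s => L (M x s) s); split; [solve_recursive|].
  intros x y (u & Hu & Hy).
  generalize (eventually_and _ _ (IHd _ _ Hu) (IHc _ _ Hy)).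
  apply eventually_impl; now intros s [-> ->].
- exists (fun x s => nat_rect (fun _ => nat) (L (p1 x) s)
    (fun m v => M ⟨p1 x, ⟨m, v⟩⟩ s) (p2 x)); split; [solve_recursive|].
  intros x y; cbn [eval]; fold (p1 x) (p2 x).
  generalize (p1 x) (p2 x); clear x; intros x n; revert y.
  induction n as [|n IHn]; cbn; intros y; [apply IHc|].
  intros (v & Hv & Hy).
  generalize (eventually_and _ _ (IHn _ Hv) (IHd _ _ Hy)).
  apply eventually_impl; now intros s [-> ->].
- exists (fun x s => first_zero (fun n => L ⟨x, n⟩ s) s).
  split; [solve_recursive|].
  intros x y [Hy Hm].
  assert (H : eventually (fun s => forall m, m < y -> L ⟨x, m⟩ s <> 0)).
  { apply eventually_forall_lt; intros m Lm; destruct (Hm m Lm) as [k Hk].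
    generalize (IHc _ _ Hk); apply eventually_impl; now intros s ->. }
  generalize (eventually_and _ _ (eventually_and _ _ H (IHc _ _ Hy))
    (eventually_ge (S y))).
  apply eventually_impl; intros s [[H1 H2] H3]; now apply first_zero_eq.
Qed.

Lemma limit_lemma X g :
  Delta02 X -> computes X g -> exists L,
    recursive_in empty_set (fun z => L (p1 z) (p2 z)) /\ limit_of L g.
Proof.
intros HX Hg; apply computes_recursive_in in Hg as [c Hc].
destruct (Delta02_limit X HX) as (LX & HLX & LimX).
destruct (eval_limit X LX HLX LimX c) as (L & HL & Lim).
exists L; split; trivial; intros x; apply Lim, Hc.
Qed.

(** Whether [L x] changes after stage [t] is a halting question, so the jump of the empty set can
    search for a [t] after which nothing changes; the limit guarantees that one exists. *)
Lemma limit_modulus L g :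
  recursive_in empty_set (fun z => L (p1 z) (p2 z)) -> limit_of L g ->
  exists T, recursive_in (jump empty_set) T /\
    forall x s, T x <= s -> L x s = g x.
Proof.
intros HL Lim.
(* Here [w] is ⟨⟨⟨x, t⟩, e⟩, n⟩, with [e] the input on which the jump runs the program, namely its
   own index. The two truncated differences add up to the distance of [u] and [v], so [h w = 0]
   means that a change occurs at [t + n]. *)
set (h := fun w =>
  let x := p1 (p1 (p1 w)) in let t := p2 (p1 (p1 w)) in
  let u := L x (t + p2 w) in let v := L x t in
  match (u - v) + (v - u) with 0 => 1 | S _ => 0 end).
assert (Hh : recursive_in empty_set h).
{ change (recursive_in empty_set (fun w => h w)); unfold h; solve_recursive. }
destruct Hh as [c Hc].
set (i := fun k => encode (smn_code (Mu c) k)).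
assert (Hi : forall x t, jump empty_set (i ⟨x, t⟩) = true <->
  exists n, L x (t + n) <> L x t).
{ intros x t; rewrite jump_true; unfold i; split.
  - intros [n Hn]; exists n.
    apply phi_encode, eval_smn_code, (eval_Mu _ _ _ Hc) in Hn as [Hn _].
    unfold h in Hn; cbn zeta in Hn; simpl_pair_in Hn.
    intros E; rewrite E, Nat.sub_diag in Hn; discriminate Hn.
  - intros [n Hn].
    destruct (least_zero (fun n => h ⟨⟨⟨x, t⟩, i ⟨x, t⟩⟩, n⟩) n) as (m & Hm).
    + unfold h; cbn zeta; simpl_pair.
      destruct (L x (t + n) - L x t + _) eqn:E; [exfalso; lia | easy].
    + exists m; now apply phi_encode, eval_smn_code, (eval_Mu _ _ _ Hc). }
destruct (recursive_search (jump empty_set)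
  (fun x t => Nat.b2n (jump empty_set (i ⟨x, t⟩)))) as (T & HT & HT0).
- assert (recursive_in (jump empty_set) i) by apply recursive_smn.
  solve_recursive.
- intros x; destruct (Lim x) as [t Ht]; exists t.
  enough (jump empty_set (i ⟨x, t⟩) = false) as -> by easy.
  apply not_true_iff_false; rewrite Hi; intros [n Hn]; apply Hn.
  rewrite !Ht; lia.
- exists T; split; trivial; intros x s Hs.
  assert (Hcst : forall n, L x (T x + n) = L x (T x)).
  { intros n; apply NNPP; intros Hn; specialize (HT0 x); cbn beta in HT0.
    rewrite (proj2 (Hi x (T x)) (ex_intro _ n Hn)) in HT0; discriminate HT0. }
  (* Stage [T x + t] lies beyond both thresholds, so the constant value there is the limit. *)
  destruct (Lim x) as [t Ht]; rewrite <- (Ht (T x + t)) by lia.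
  replace s with (T x + (s - T x)) by lia; now rewrite !Hcst.
Qed.

(** * Generalized lowness *)

Theorem mainTheorem5 (X A : cantor_space)
  (X_Delta02 : Delta02 X) (X_DNC : has_DNC_degree_rel X A) :
  GL1 A.
Proof.
destruct X_DNC as (g & Hg & DNC).
destruct (limit_lemma X g X_Delta02 Hg) as (L & HL & Lim).
destruct (limit_modulus L g HL Lim) as (T & HT & Mod).
destruct (recursive_halting_stage A) as (h & Hh & Hjump & Hmono).
destruct (recursive_in_empty_set A _ HL) as [l Hl].
destruct Hh as [k Hk].
(* On ⟨e, z⟩, [Mu k] finds the least halting stage [s] of [e], and [l] then returns [L z s].
   Freezing [e] gives the program with index [p e]. *)
set (q := Comp l (Pair Snd (Comp (Mu k) Fst))).
set (p := fun e => encode (smn_code q e)).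
assert (Hp : forall e s, h e s = 0 -> (forall m, m < s -> h e m <> 0) ->
  L (p e) s <> g (p e)).
{ intros e s H0 Hm E; apply (DNC (p e) (L (p e) s)); [|easy].
  apply phi_encode, eval_smn_code; exists ⟨p e, s⟩; split.
  - exists (p e), s; split; [symmetry; apply p2_pair|]; split; trivial.
    exists e; split; [symmetry; apply p1_pair|].
    apply (eval_Mu A k _ Hk); simpl_pair; split; trivial.
    intros m Lm; simpl_pair; auto.
  - specialize (Hl ⟨p e, s⟩); now simpl_pair_in Hl. }
apply computes_recursive_in.
apply recursive_ext with
  (fun e => match h e (T (p e)) with 0 => 1 | S _ => 0 end).
- intros e; destruct (jump A e) eqn:Ej.
  + apply Hjump in Ej as [n Hn].
    destruct (least_zero (h e) n Hn) as (s & Hs & Hm).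
    (* A halting stage [s] at or after [T (p e)] would give [L (p e) s = g (p e)], against [Hp].
       Hence [s] comes earlier, and by monotonicity the machine has halted at [T (p e)]. *)
    destruct (Nat.le_gt_cases (T (p e)) s) as [Ls|Ls].
    * destruct (Hp e s Hs Hm); auto.
    * rewrite (Hmono e s) by (trivial; lia); easy.
  + destruct (h e (T (p e))) eqn:E; trivial.
    apply not_true_iff_false in Ej; destruct Ej; apply Hjump; eauto.
(* The [A] half of the join runs [h], the other half computes the modulus [T]. *)
- assert (Hh : recursive_in (join A (jump empty_set)) (fun z => h (p1 z) (p2 z))).
  { apply (recursive_in_trans A); [apply recursive_join_l | now exists k]. }
  apply (recursive_in_trans _ _ _ (recursive_join_r A (jump empty_set))) in HT.
  assert (recursive_in (join A (jump empty_set)) p) by apply recursive_smn.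
  solve_recursive.
Qed.
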